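(* For every integer $k \geq 1$ and every $\varepsilon > 0$, there exists a prophet inequality instance $(E, \mathcal{F}, \{\mathcal{D}_e\}_{e \in E})$ such that: (a) $(E,\mathcal{F})$ is a graphic matroid with girth $k$, and (b) the instance $(E, \mathcal{F}, \{\mathcal{D}_e\}_{e \in E})$ does not admit a $(\frac{1}{2}+\varepsilon)$-competitive prophet inequality.
   Context: A prophet inequality instance consists of a finite ground set $E$, a downward-closed family $\mathcal{F}\subseteq 2^E$ of feasible sets, and a distribution $\mathcal{D}_e$ of nonnegative reals for each $e\in E$. Elements arrive one at a time in an order fixed in advance by an adversary (based only on the distributions); when $e$ arrives, $v_e\sim\mathcal{D}_e$ (independent across elements) is revealed and an online algorithm must immediately and irrevocably accept or reject $e$, keeping the set $A$ of accepted elements in $\mathcal{F}$ at all times. For $c\in[0,1]$, the instance admits a $c$-competitive prophet inequality if there is an online algorithm with $\mathbb{E}[\sum_{e\in A}v_e]\ge c\cdot\mathbb{E}[\max_{S\in\mathcal{F}}\sum_{e\in S}v_e]$ (expectation over the values and the algorithm's randomness) for every arrival order; it fails to admit one if for some arrival order no online algorithm achieves this. A graphic matroid on the edge set $E$ of an undirected graph has as independent sets the acyclic edge subsets (forests). The girth of a matroid is the size of its smallest dependent set. *)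

(* Defs.v *)
From HB Require Import structures.
From mathcomp Require Import all_boot all_order all_algebra.
From mathcomp Require Import all_classical all_reals all_analysis.

Set Implicit Arguments.
Unset Strict Implicit.
Unset Printing Implicit Defensive.

Import Order.TTheory GRing.Theory Num.Theory.
Import numFieldNormedType.Exports.

Local Open Scope classical_set_scope.
Local Open Scope ring_scope.

Section TupleProbability.
Context {R : realType}.

Definition cons_pair n (p : R * n.-tuple R) :
  n.+1.-tuple R := [tuple of p.1 :: p.2].

Lemma measurable_cons_pair n : measurable_fun [set: _] (@cons_pair n).
Proof. exact: (measurable_cons measurable_fst measurable_snd). Qed.

HB.instance Definition _ n :=
  isMeasurableFun.Build _ _ _ _ (@cons_pair n) (@measurable_cons_pair n).

(* The product of the D i as a probability on n-tuples; it is characterised on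
   boxes by tuple_probabilityE below. *)
Fixpoint tuple_probability n :
    ('I_n -> probability R R) ->
    probability (n.-tuple R) R :=
  match n with
  | 0 => fun _ => \d_ [tuple]
  | n'.+1 => fun D =>
      distribution (D ord0 \x tuple_probability (fun i => D (lift ord0 i)))%E
        (@cons_pair n')
  end.

Lemma tuple_probabilityE n (D : 'I_n -> probability R R)
    (B : 'I_n -> set R) :
  (forall i, measurable (B i)) ->
  tuple_probability D [set v | forall i, B i (tnth v i)]
  = (\prod_(i < n) D i (B i))%E.
Proof.
elim: n D B => [|n IH] D B mB /=.
  rewrite big_ord0 /dirac/= indicE.
  by rewrite mem_set//= => -[].
rewrite /distribution /pushforward /=.
pose B' (i : 'I_n) := B (lift ord0 i).
have -> : @cons_pair n @^-1` [set v | forall i, B i (tnth v i)] =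
    B ord0 `*` [set v | forall i, B' i (tnth v i)].
  apply/seteqP; split => [[x v] /= h|[x v] /= [h0 h] i].
    split; first exact: (h ord0).
    by move=> i; have := h (lift ord0 i); rewrite tnthS.
  case: (unliftP ord0 i) => [j ->|->//].
  by rewrite tnthS; exact: h.
rewrite product_measure1E//; first last.
  have -> : [set v : n.-tuple R | forall i, B' i (tnth v i)] =
      \big[setI/setT]_(i < n) ((fun v => tnth v i) @^-1` B' i).
    apply/seteqP; split => v /=; rewrite -bigcap_seq /=.
      by move=> h i _; exact: h.
    by move=> h i; apply: h; rewrite /= mem_index_enum.
  apply: bigsetI_measurable => i _; rewrite -[X in measurable X]setTI.
  by apply: (@measurable_tnth _ _ n i) => //; exact: mB.
by rewrite big_ord_recl -(IH (fun i => D (lift ord0 i)) B')// => i; exact: mB.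
Qed.

End TupleProbability.

Record prophet_instance (R : realType) := ProphetInstance {
  ground : finType;
  feasible : {set {set ground}};
  law : ground -> probability R R;
  feasible0 : finset.set0 \in feasible;
  feasible_down : forall S T : {set ground},
    S \subset T -> T \in feasible -> S \in feasible;
  law_ge0 : forall e, law e [set x : R | 0 <= x] = 1%E }.

Section Graphic.
Variables (V E : finType) (ends : E -> V * V).

(* An edge is undirected: the order of the pair [ends e] is irrelevant. *)
Definition joins (e : E) (x y : V) : bool :=
  (ends e == (x, y)) || (ends e == (y, x)).

(* [:: (x_1, e_1); ...; (x_m, e_m)] with m >= 1, the x_i distinct, the e_i
   distinct and e_i joining x_i to x_(i+1), indices modulo m.  A loop is the
   case m = 1, a pair of parallel edges the case m = 2. *)
Definition graph_cycle (c : seq (V * E)) : bool :=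
  [&& c != [::], uniq (unzip1 c), uniq (unzip2 c)
    & cycle (fun p q : V * E => joins p.2 p.1 q.1) c].

Definition forest (S : {set E}) : Prop :=
  forall c, graph_cycle c -> ~ {subset unzip2 c <= S}.

End Graphic.

Definition graphic_matroid (E : finType) (F : {set {set E}}) : Prop :=
  exists (V : finType) (ends : E -> V * V),
    forall S : {set E}, S \in F <-> forest ends S.

Definition has_girth (E : finType) (F : {set {set E}}) (k : nat) : Prop :=
  (exists2 S : {set E}, S \notin F & #|S| = k) /\
  (forall S : {set E}, S \notin F -> (k <= #|S|)%N).

Section Prophet.
Context {R : realType} (I : prophet_instance R).
Local Notation E := (ground I).

(* A realisation of the values, stored along the enumeration of the ground set;
   the indexing is unrelated to the arrival order. *)
Definition values := #|E|.-tuple R.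

Definition value (v : values) (e : E) : R := tnth v (enum_rank e).

Definition values_law : probability values R :=
  tuple_probability (fun i => law (enum_val i)).

Definition total_value (v : values) (S : {set E}) : R := \sum_(e in S) value v e.

(* The default 0 is the total of the feasible set set0. *)
Definition prophet_value (v : values) : R :=
  \big[Order.max/0]_(S in feasible I) total_value v S.

Definition arrival_order (s : seq E) : Prop := perm_eq s (enum E).

(* The seed w : W is the internal randomness; the algorithm may depend on the
   instance and on the arrival order s.  Past decisions are determined by the
   seed and the past values, so the decision on e is a function of the seed and
   of the values revealed up to the arrival of e. *)
Record online_algorithm (s : seq E) (d : measure_display)
    (W : measurableType d) := OnlineAlgorithm {
  accepted : W -> values -> {set E};
  accepted_measurable : forall e,
    measurable [set x : W * values | e \in accepted x.1 x.2];
  accepted_online : forall w v v' e,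
    (forall e', (index e' s <= index e s)%N -> value v e' = value v' e') ->
    (e \in accepted w v) = (e \in accepted w v');
  accepted_feasible : forall w v t,
    [set e in accepted w v | e \in take t s]%SET \in feasible I }.

Definition admits_prophet_inequality (c : R) : Prop :=
  forall s : seq E, arrival_order s ->
  exists (d : measure_display) (W : measurableType d) (Q : probability W R)
    (A : online_algorithm s W),
    (c%:E * 'E_values_law[prophet_value]
     <= 'E_(Q \x values_law)[fun x => total_value x.2 (accepted A x.1 x.2)])%E.

End Prophet.

(* Main.v *)
From HB Require Import structures.
Require Import Defs.
From mathcomp Require Import all_boot all_order all_algebra.
From mathcomp Require Import all_classical all_reals all_analysis.
From mathcomp Require Import all_fingroup measurable_realfun zify ring lra.

(** Take a multigraph on a set of centers with many more edges than vertices
    and without short cycles, and subdivide every edge [x] by a leaf; add a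
    disjoint [k]-cycle of worthless edges to make the girth exactly [k].  Of the
    two halves of [x], the low one is worth [1] and arrives in a first phase,
    the high one is worth [1/p] with probability [p] and arrives afterwards.
    One half of each [x] is always a star forest, so the prophet collects
    [1 + (1 - p)] per leaf in expectation.  A forest contains both halves of at
    most as many leaves as there are centers, which is negligible, so an online
    algorithm essentially chooses for each leaf between the sure value [1] and
    a lottery of mean [1].

    The dense graph without short cycles is (the bipartite double cover of) a
    Cayley graph: the letters of an alphabet of size [d] act as involutions on
    the reduced words of length at most [r], and a reduced word of length at
    most [r] moves the empty word to that word read backwards. *)

Set Implicit Arguments.
Unset Strict Implicit.
Unset Printing Implicit Defensive.
Import Order.TTheory GRing.Theory Num.Theory.
Import numFieldNormedType.Exports.

(** * Cycles, walks and forests in multigraphs *)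

Section GraphCycles.
Variables (V E : finType) (ends : E -> V * V).
Implicit Types (S T : {set E}) (c : seq (V * E)).

Definition incident (e : E) (x : V) : bool :=
  ((ends e).1 == x) || ((ends e).2 == x).

Lemma joins_incident e x y : joins ends e x y -> incident e x && incident e y.
Proof. by rewrite /joins /incident; case/orP => /eqP -> /=; rewrite !eqxx ?orbT. Qed.

Lemma incident_joins e x : incident e x -> exists y, joins ends e x y.
Proof.
rewrite /joins /incident; case: (ends e) => a b /= /orP[] /eqP <-.
  by exists b; rewrite eqxx.
by exists a; rewrite eqxx orbT.
Qed.

(** The cycle is unrolled into a periodic walk, so that later arguments can move along it without
    arithmetic modulo its length. A loop repeats its only edge, hence the guard on the last
    clause. *)
Lemma graph_cycle_walk c : graph_cycle ends c ->
  exists (v : nat -> V) (e : nat -> E),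
  [/\ forall t, joins ends (e t) (v t) (v t.+1),
      forall t, v (t + size c) = v t,
      forall t, e (t + size c) = e t,
      forall f, f \in unzip2 c <-> exists t, e t = f
    & 1 < size c -> forall t, e t.+1 != e t].
Proof.
case/and4P => c0 u1 u2 cc.
have c_gt0 : 0 < size c by case: c c0 {u1 u2 cc}.
case Ec : c c0 => [//|p0 c'] _; rewrite -Ec.
pose P t := nth p0 c (t %% size c).
have tc t : t %% size c < size c by rewrite ltn_mod.
have PS t : joins ends (P t).2 (P t).1 (P t.+1).1.
  have h s : s < size c ->
      joins ends (nth p0 c s).2 (nth p0 c s).1 (nth p0 (rcons c' p0) s).1.
    move=> sc; have : path (fun p q : V * E => joins ends p.2 p.1 q.1) p0 (rcons c' p0).
      by move: cc; rewrite Ec.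
    move/(pathP p0) => /(_ s); rewrite size_rcons -rcons_cons -Ec nth_rcons sc.
    by apply; rewrite Ec in sc.
  rewrite /P -addn1 -modnDml addn1; move: (tc t); set s := t %% size c => sc.
  have := h s sc; rewrite nth_rcons.
  have [sc1|] := ltnP s.+1 (size c).
    have s1 : s < size c' by rewrite Ec in sc1.
    by rewrite s1 modn_small // [in nth p0 c s.+1]Ec.
  rewrite leq_eqVlt ltnNge sc /= orbF => /eqP es.
  have -> : s.+1 %% size c = 0 by rewrite -es modnn.
  have -> : s = size c' by rewrite Ec /= in es; case: es.
  by rewrite ltnn eqxx [in nth p0 c 0]Ec.
exists (fun t => (P t).1), (fun t => (P t).2); split => //.
- by move=> t; rewrite /P modnDr.
- by move=> t; rewrite /P modnDr.
- move=> f; split=> [/(nthP p0.2)[i]|[t <-]].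
    rewrite size_map => ic <-; exists i.
    by rewrite /P modn_small // (nth_map p0).
  by apply: map_f; rewrite mem_nth.
- move=> c1 t; apply/eqP => /eqP.
  rewrite /P -!(nth_map p0 p0.2) ?tc // nth_uniq ?size_map ?tc //.
  rewrite -addn1 -[X in _ == X %% _]addn0 eqn_modDl mod0n modn_small //.
Qed.

(* The shortest return of the vertex walk is a cycle: its vertices are distinct
   by minimality. *)
Lemma walk_graph_cycle (v : nat -> V) (e : nat -> E) :
  (forall t, joins ends (e t) (v t) (v t.+1)) ->
  (forall t, e t.+1 != e t) ->
  exists2 c, graph_cycle ends c & {subset unzip2 c <= [pred f | `[< exists t, f = e t >]]}.
Proof.
move=> vj eS.
have exL : exists L, (0 < L) && `[< exists i, v i = v (i + L) >].
  have : ~~ injectiveb (fun i : 'I_(#|V|).+1 => v i).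
    apply/negP => /injectiveP /leq_card; rewrite card_ord; lia.
  case/injectivePn => i [j ij vij].
  wlog lij : i j ij vij / i < j.
    move=> H; have [|] := ltnP i j; first exact: H.
    rewrite leq_eqVlt => /orP[/eqP/val_inj ji|]; first by rewrite ji eqxx in ij.
    by apply: H => //; rewrite eq_sym.
  exists (j - i); rewrite subn_gt0 lij; apply/asboolP; exists i.
  by rewrite subnKC // ltnW.
have [L /andP[L0 /asboolP[i viL]] Lmin] := ex_minnP exL.
have vinj s t : s < t -> t < L -> v (i + s) <> v (i + t).
  move=> st tL vst; suff : L <= t - s by lia.
  apply: Lmin; rewrite subn_gt0 st; apply/asboolP; exists (i + s).
  by rewrite -addnA subnKC // ltnW.
(* An edge repeated at times [s < t] would make the vertex at time [t] equal to the one at time [s]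
   or [s.+1]. Minimality of [L] excludes this unless [t = s.+1], which is backtracking. *)
have einj s t : s < t -> t < L -> e (i + s) <> e (i + t).
  move=> st tL est; have [tS|tS] := eqVneq t s.+1.
    by have := eS (i + s); rewrite est tS addnS eqxx.
  have := vj (i + s); have := vj (i + t); rewrite -est -!addnS /joins.
  have sSt : s.+1 < t by lia.
  have vst := vinj _ _ st tL; have vSst := vinj _ _ sSt tL.
  by case/orP => /eqP ->; case/orP => /eqP h; injection h; congruence.
exists (mkseq (fun t => (v (i + t), e (i + t))) L); last first.
  move=> f; rewrite /unzip2 -map_comp => /mapP[t _ ->] /=.
  by apply/asboolP; exists (i + t).
apply/and4P; split.
- by rewrite -size_eq0 size_mkseq -lt0n.
- rewrite /unzip1 -map_comp map_inj_in_uniq ?iota_uniq // => s t.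
  rewrite !mem_iota /= => sL tL /= vst.
  by case: (ltngtP s t) => // /vinj; [move/(_ tL)|move/(_ sL)]; rewrite vst.
- rewrite /unzip2 -map_comp map_inj_in_uniq ?iota_uniq // => s t.
  rewrite !mem_iota /= => sL tL /= vst.
  by case: (ltngtP s t) => // /einj; [move/(_ tL)|move/(_ sL)]; rewrite vst.
- case: L L0 viL {Lmin vinj einj} => // L _ viL; rewrite /mkseq /=.
  set p0 := (_, _); apply/(pathP p0) => t.
  rewrite size_rcons size_map size_iota ltnS => tL.
  have -> : nth p0 (p0 :: rcons [seq (v (i + t), e (i + t)) | t <- iota 1 L] p0) t
     = (v (i + t), e (i + t)).
    case: t tL => // t tL /=; rewrite nth_rcons size_map size_iota tL.
    by rewrite (nth_map 0) ?size_iota // nth_iota.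
  rewrite nth_rcons size_map size_iota.
  have [tL'|] := ltnP t L.
    by rewrite (nth_map 0) ?size_iota // nth_iota // add1n addnS; exact: vj.
  move=> Lt; have -> : t = L by lia.
  by rewrite eqxx /= addn0 viL addnS; exact: vj.
Qed.

(** The second edge at [x] is the predecessor or the successor of [e] on the unrolled walk. Shifting
    by one period provides a predecessor even at time 0. *)
Lemma cycle_two_edges c e x : graph_cycle ends c -> 1 < size c ->
  e \in unzip2 c -> incident e x ->
  exists e', [/\ e' \in unzip2 c, e' != e & incident e' x].
Proof.
move=> /graph_cycle_walk [v [w [vj vL wL cE wS]]] c1.
move=> /cE[t <-] ix; have wc s : w s \in unzip2 c by apply/cE; exists s.
have [-> |->] : x = v t \/ x = v t.+1.
  move: ix (vj t); rewrite /incident /joins; case: (ends _) => a b /=.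
  by case/orP => /eqP <- /orP[] /eqP h; injection h; auto.
- exists (w (t + size c).-1); split => //.
    rewrite -(wL t) eq_sym -[X in w X != _](@prednK (t + size c)) ?wS //; lia.
  have := vj (t + size c).-1; rewrite prednK ?vL; last lia.
  by case/joins_incident/andP.
- by exists (w t.+1); split; rewrite ?wS //; case/joins_incident/andP: (vj t.+1).
Qed.

Lemma cycle_loop c : graph_cycle ends c -> size c <= 1 ->
  exists e x, e \in unzip2 c /\ joins ends e x x.
Proof.
case: c => [|[x e] [|]] //= /and4P[_ _ _ /=]; rewrite andbT => h _.
by exists e, x; rewrite inE eqxx.
Qed.

Lemma forestPn S : ~ forest ends S ->
  exists2 c, graph_cycle ends c & {subset unzip2 c <= S}.
Proof. by move=> /existsNP[c /not_implyP[gc /contrapT cS]]; exists c. Qed.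

Lemma forest_sub S T : S \subset T -> forest ends T -> forest ends S.
Proof. by move=> /fintype.subsetP ST fT c /fT h cS; apply: h => e /cS /ST. Qed.

Definition covered S : {set V} := [set x | [exists e in S, incident e x]].

Lemma coveredS S T : S \subset T -> covered S \subset covered T.
Proof.
move=> /fintype.subsetP ST; apply/fintype.subsetP => x; rewrite !inE => /exists_inP[e eS ex].
by apply/exists_inP; exists e => //; exact: ST.
Qed.

(* The hypothesis keeps a non-backtracking walk from ever getting stuck. *)
Lemma min_degree2_cycle S : S != finset.set0 ->
  (forall x e, e \in S -> incident e x ->
    exists2 e', e' \in S & (e' != e) && incident e' x) -> ~ forest ends S.
Proof.
case/set0Pn => e0 e0S H fS.
(* The states of the walk are edges of [S] with a chosen starting endpoint; each step crosses the
   edge and leaves its other end by a different edge. *)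
pose D := {p : V * E | (p.2 \in S) && incident p.2 p.1}.
have step (p : D) : exists q : D, joins ends (sval p).2 (sval p).1 (sval q).1 /\
     (sval q).2 != (sval p).2.
  case: p => [[x e] /= /andP[eS ex]].
  have [y jxy] := incident_joins ex.
  have [e' e'S /andP[e'e e'y]] := H y e eS (proj2 (andP (joins_incident jxy))).
  have q : (e' \in S) && incident e' y by rewrite e'S.
  by exists (exist _ (y, e') q).
have [nx nxP] := choice step.
have p0P : (e0 \in S) && incident e0 (ends e0).1 by rewrite e0S /incident eqxx.
pose w t := iter t nx (exist _ ((ends e0).1, e0) p0P : D).
have [|t|c gc cS] := @walk_graph_cycle (fun t => (sval (w t)).1) (fun t => (sval (w t)).2).
- by move=> t; have [] := nxP (w t).
- by have [] := nxP (w t).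
- apply: (fS c gc) => f /cS /asboolP[t ->].
  by case: (w t) => p /= /andP[].
Qed.

Lemma forest_card S : forest ends S -> #|S| <= #|covered S|.
Proof.
elim: {S}#|S| {-2}S (erefl #|S|) => [|n IH] S Sn fS; first by rewrite Sn.
have [x [e [eS ex xe]]] : exists x e, [/\ e \in S, incident e x &
    forall e', e' \in S -> incident e' x -> e' = e].
  apply: contrapT => H; apply: (@min_degree2_cycle S) fS.
    by rewrite -card_gt0 Sn.
  move=> x e eS ex; apply: contrapT => H2; apply: H; exists x, e; split => // e' e'S e'x.
  by apply/eqP; apply/negPn/negP => ne; apply: H2; exists e' => //; rewrite ne.
have cS : #|S :\ e| = n by move: (cardsD1 e S); rewrite eS Sn; lia.
have := IH _ cS (forest_sub (finset.subsetDl _ _) fS).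
rewrite cS Sn => h.
apply: leq_ltn_trans h _; apply: proper_card; apply/properP; split.
  exact/coveredS/finset.subsetDl.
exists x; first by rewrite inE; apply/exists_inP; exists e.
rewrite inE; apply/exists_inP => -[e' /setD1P[ne e'S] e'x].
by rewrite (xe e') ?eqxx in ne.
Qed.

End GraphCycles.

(** * Involutions on truncated reduced words *)

Section ReducedWords.
Variables (d r : nat).
Implicit Types (i j : 'I_d) (s : seq 'I_d).

Definition reduced s : bool := sorted (fun i j => i != j) s.

(* Left multiplication by [i] in the free product of [d] copies of Z/2,
   truncated to reduced words of length at most [r]. *)
Definition toggle i s : seq 'I_d :=
  if ~~ reduced s then s
  else if ohead s == Some i then behead s
  else if size s < r then i :: s else s.

(** Reducedness guarantees that, once a leading [i] is deleted, the next letter is not [i], so the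
    second toggle puts it back. Words that are not reduced, and words of length [r] not starting
    with [i], are fixed points. *)
Lemma toggleK s i : size s <= r -> toggle i (toggle i s) = s.
Proof.
rewrite /toggle /reduced; case: (boolP (sorted _ s)) => [rs|/negPf rs] sr; last first.
  by rewrite /= rs.
rewrite /=; case: s rs sr => [|j s] /= rs sr.
  by case: (ltnP 0 r) => //= r0; rewrite ?eqxx // ltnNge r0.
have [/eqP[ji]|ji] := boolP (Some j == Some i).
  rewrite ji in rs *.
  rewrite (path_sorted rs) /= sr; case: s rs {sr} => //= a s /andP[ja _].
  by case: eqP => // -[ai]; move: ja; rewrite ai ?eqxx.
case: ltnP => /= sr2; last by rewrite rs (negPf ji) ltnNge sr2.
have -> : i != j by apply: contraNneq ji => ->.
by rewrite rs /= eqxx.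
Qed.

Lemma size_toggle s i : size s <= r -> size (toggle i s) <= r.
Proof.
rewrite /toggle; do 2?[case: ifP => //]; last by move=> *; case: ifP.
by move=> *; rewrite size_behead; lia.
Qed.

Definition bounded_toggle i (s : r.-bseq 'I_d) : r.-bseq 'I_d :=
  Bseq (size_toggle i (size_bseq s)).

Lemma bounded_toggleK i : involutive (bounded_toggle i).
Proof. by move=> s; apply: val_inj => /=; rewrite toggleK ?size_bseq. Qed.

Definition toggle_perm i : {perm r.-bseq 'I_d} :=
  perm (inv_inj (bounded_toggleK i)).

Lemma toggle_permK i : (toggle_perm i * toggle_perm i = 1)%g.
Proof. by apply/permP => s; rewrite !permE /= !permE bounded_toggleK. Qed.

(* Read from the empty word, the toggles spell out the word itself. *)
Lemma toggle_walk_aperiodic (g : nat -> {perm r.-bseq 'I_d}) (i : nat -> 'I_d) L :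
  (forall t, g t.+1 = g t * toggle_perm (i t))%g ->
  (forall t, i t.+1 != i t) -> 0 < L <= r -> g L != g 0.
Proof.
(* The point [p] is the one that [g 0] sends to the empty word. Permutation products act from left
   to right, so each further generator prepends its letter, and the length of the image of [p] tells
   [g L] from [g 0]. *)
move=> gS iS /andP[L0 Lr]; pose p := (g 0)^-1%g [bseq].
have H t : t <= r -> [/\ reduced (g t p), size (g t p) = t &
    (0 < t -> ohead (g t p) = Some (i t.-1))].
  elim: t => [|t IH] tr; first by rewrite /p permKV.
  have [rt st ht] := IH (ltnW tr).
  have -> : (g t.+1 p : seq _) = i t :: g t p.
    rewrite gS permE /= permE /= /toggle rt st tr /=.
    case: t {IH gS tr} rt st ht => [|t] rt st ht; first by rewrite (size0nil st).
    by rewrite ht //=; case: eqP => // -[h]; move: (iS t); rewrite h eqxx.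
  rewrite /= st; split => //.
  case: t {IH gS tr} st ht rt => [|t] st ht; first by rewrite (size0nil st).
  case: (val (g t.+1 p)) ht => [|a s] /= ht; first by have := ht isT.
  by rewrite /reduced /= => ->; case: (ht isT) => ->; rewrite iS.
have [_ sL _] := H L Lr; have [_ s0 _] := H 0 (leq0n _).
by apply/eqP => gL; move: sL; rewrite gL s0; lia.
Qed.

End ReducedWords.

(** * The subdivided graph with an additional cycle *)

Section SubdividedGraph.
Variables (X C : finType) (k : nat) (center : X -> bool -> C).

Definition spoke := (X * bool + 'I_k)%type.
Definition node := (X + C + 'I_k)%type.

(* Each [x : X] is the midpoint of a subdivided edge joining its two centers;
   the extra ['I_k] is a disjoint cycle of length [k]. *)
Definition spoke_ends (e : spoke) : node * node :=
  match e with
  | inl (x, b) => (inl (inl x), inl (inr (center x b)))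
  | inr j => (inr j, inr (ordS j))
  end.

Lemma incident_leaf e x :
  incident spoke_ends e (inl (inl x)) -> exists b, e = inl (x, b).
Proof. by case: e => [[y b]|j] /=; rewrite /incident /= ?orbF // => /eqP[->]; exists b. Qed.

Lemma incident_extra e j :
  incident spoke_ends e (inr j) -> exists2 i, e = inr i & (i = j \/ ordS i = j).
Proof.
case: e => [[y b]|i] /=; rewrite /incident //=.
by case/orP => /eqP[h]; exists i => //; auto.
Qed.

Lemma spoke_cycle_gt1 c x b : graph_cycle spoke_ends c ->
  inl (x, b) \in unzip2 c -> 1 < size c.
Proof.
move=> gc; case: c gc => [|[y e] [|]] //= /and4P[_ _ _ /=].
rewrite andbT inE => h /eqP ee; move: h; rewrite -ee /joins /=.
by case/orP => /eqP[<-].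
Qed.

(** A cycle without extra edges passes through some leaf vertex, where it would need two distinct
    edges, that is, both halves. *)
Lemma forest_star (S : {set spoke}) : (forall j, inr j \notin S) ->
  (forall x b, inl (x, b) \in S -> inl (x, ~~ b) \notin S) -> forest spoke_ends S.
Proof.
move=> S1 S2 c gc cS.
have [[[x b]|j] ec] : exists e, e \in unzip2 c.
- by case: c gc {cS} => // [[v e] c] _; exists e; rewrite inE eqxx.
- have [|e' [e'c e'e /incident_leaf [b' eb']]] :=
    cycle_two_edges (x := inl (inl x)) gc (spoke_cycle_gt1 gc ec) ec.
    by rewrite /incident /= eqxx.
  have := S2 x b (cS _ ec); have := cS _ e'c.
  have -> : ~~ b = b' by move: e'e; rewrite eb'; case: (b) (b') => [] [] //; rewrite eqxx.
  by rewrite eb' => ->.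
- by have := S1 j; rewrite cS.
Qed.

(** Let [B] be the set being counted. The halves over [B] form a forest with [2 * #|B|] edges that
    covers at most [#|B| + #|C|] vertices, so [forest_card] applies. *)
Lemma forest_both (S : {set spoke}) : forest spoke_ends S ->
  #|[set x | (inl (x, false) \in S) && (inl (x, true) \in S)]| <= #|C|.
Proof.
set B := [set x | _] => fS.
pose S' : {set spoke} := [set inl xb | xb in finset.setX B [set: bool]].
have S'S : S' \subset S.
  apply/fintype.subsetP => e /imsetP[[x b] /setXP[/= + _] ->].
  by rewrite inE => /andP[h0 h1]; case: b.
have := forest_card (forest_sub S'S fS).
rewrite card_imset; last by move=> ? ? [].
rewrite cardsX cardsT card_bool.
have : covered spoke_ends S' \subset [set inl (inl x) | x in B] :|: [set inl (inr c) | c : C].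
  apply/fintype.subsetP => u; rewrite inE => /exists_inP[e /imsetP[[x b] /setXP[/= xB _] ->]].
  rewrite /incident /= => /orP[] /eqP <-; rewrite finset.in_setU.
    by rewrite imset_f.
  by rewrite (imset_f (fun c => inl (inr c))) // orbT.
move/subset_leq_card; rewrite cardsU => h1 h2.
have : #|[set (inl (inl x) : node) | x in B]| <= #|B| by exact: leq_imset_card.
have : #|[set (inl (inr c) : node) | c : C]| <= #|C|.
  by apply: leq_trans (leq_imset_card _ _) _; rewrite max_card.
move=> h3 h4; have := leq_trans h2 (leq_trans h1 (leq_trans (leq_subr _ _) (leq_add h4 h3))).
by rewrite muln2 -addnn leq_add2l.
Qed.

(** At the head of an extra edge the only other edge is the next extra edge, so the cycle is forced
    through all [k] of them. A loop is possible only for [k = 1]. *)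
Lemma extra_cycle_full c j : graph_cycle spoke_ends c ->
  inr j \in unzip2 c -> k <= size c.
Proof.
move=> gc jc; have [c1|c1] := leqP (size c) 1.
  have [e [x [ec]]] := cycle_loop gc c1.
  move: e ec => [[y b]|i] ec; rewrite /joins /=.
    by case/orP => /eqP[<-].
  have c0 : 0 < size c by case: (c) gc.
  move=> h; have {h} : i.+1 %% k = i by case/orP: h => /eqP[<- [ii]]; exact: (congr1 val ii).
  have ik := ltn_ord i; have [ik'|ik'] := ltnP i.+1 k; first by rewrite modn_small //; lia.
  have ek : i.+1 = k by lia.
  by rewrite [X in X %% _]ek modnn => i0; apply: leq_trans c0; rewrite -ek -i0.
have cS i : inr i \in unzip2 c -> inr (ordS i) \in unzip2 c.
  move=> ic; have [|e [ec ei /incident_extra[i' ee [ii|/ordS_inj ii]]]] :=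
      cycle_two_edges (x := inr (ordS i)) gc c1 ic.
  - by rewrite /incident /= eqxx orbT.
  - by rewrite -ii -ee.
  - by rewrite ee ii eqxx in ei.
have ci m : inr (iter m (@ordS k) j) \in unzip2 c.
  by elim: m => //= m; exact: cS.
have iterS m : iter m (@ordS k) j = (j + m) %% k :> nat.
  elim: m => [|m IH] /=; first by rewrite addn0 modn_small.
  by rewrite IH -addn1 modnDml addn1 addnS.
have -> : size c = size (unzip2 c) by rewrite size_map.
rewrite -[X in X <= _](size_enum_ord k) -(size_map (fun i => inr i : spoke)).
apply: uniq_leq_size; first by rewrite map_inj_uniq ?enum_uniq // => ? ? [].
move=> e /mapP[i _ ->].
(* The added [k] keeps the subtraction from truncating when [i < j]. *)
have -> : i = iter (i + k - j) (@ordS k) j.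
  apply: val_inj; rewrite [RHS]iterS.
  have -> : j + (i + k - j) = i + k by have := ltn_ord j; lia.
  by rewrite modnDr modn_small.
exact: ci.
Qed.

Lemma extra_cycle_dependent : 0 < k ->
  ~ forest spoke_ends [set inr j | j : 'I_k].
Proof.
move=> k0 fS; apply: (fS [seq (inr j : node, inr j : spoke) | j <- enum 'I_k]).
  have [u1 u2] : uniq [seq (inr j : node) | j <- enum 'I_k] /\
                 uniq [seq (inr j : spoke) | j <- enum 'I_k].
    by split; rewrite map_inj_uniq ?enum_uniq // => ? ? [].
  apply/and4P; split; [|by rewrite /unzip1 -map_comp|by rewrite /unzip2 -map_comp|].
    by rewrite -size_eq0 size_map size_enum_ord -lt0n.
  rewrite cycle_map.
  apply: (@sub_cycle _ (relpre val (fun i j => j == i.+1 %% k))) => [i j /= /eqP ij|].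
    by rewrite /joins /= (_ : ordS i = j) ?eqxx //; apply: val_inj.
  rewrite -cycle_map val_enum_ord.
  case: k k0 => // m _; rewrite /= ; apply/(pathP 0) => i.
  rewrite size_rcons size_iota => im; rewrite nth_rcons size_iota.
  have -> : nth 0 (0 :: rcons (iota 1 m) 0) i = i.
    case: i im => //= i im; rewrite nth_rcons size_iota ifT // nth_iota //.
  have [im2|im2|->] := ltngtP i m; last by rewrite modnn.
    by rewrite nth_iota // add1n modn_small.
  lia.
move=> e; rewrite /unzip2 -map_comp => /mapP[j _ ->] /=.
by rewrite imset_f.
Qed.

End SubdividedGraph.

(** * Absence of short cycles in the Cayley graph *)

Section CayleyCenters.
Variables (d r k : nat).
Local Notation G := {perm r.-bseq 'I_d}.

(* The edges of the bipartite double cover of the Cayley graph of [G] with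
   respect to the toggles: [(g, i)] joins [(g, false)] to [(g s_i, true)]. *)
Definition cayley_center (x : G * 'I_d) (b : bool) : G * bool :=
  (if b then x.1 * toggle_perm r x.2 else x.1, b)%g.

(** Since generators are involutions, crossing an edge in either direction multiplies by the same
    generator on the right. *)
Lemma cayley_center_flip x b :
  (cayley_center x (~~ b)).1 = ((cayley_center x b).1 * toggle_perm r x.2)%g.
Proof. by case: b => //=; rewrite -mulgA toggle_permK mulg1. Qed.

(** This turns the absence of backtracking into the absence of repeated consecutive letters. *)
Lemma cayley_center_inj x y b :
  cayley_center x b = cayley_center y b -> x.2 = y.2 -> x = y.
Proof.
case: x y => [g i] [h j] /= + ij; rewrite -ij /cayley_center /=.
by case: b => -[] => [/mulIg -> | ->].
Qed.

Local Notation ends := (@spoke_ends _ _ k cayley_center).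

(** Every second vertex of the cycle is a center, and two steps multiply its group element by one
    generator. Consecutive letters differ, so a return within [r] double steps would contradict
    [toggle_walk_aperiodic]. *)
Lemma cayley_cycle_long c : graph_cycle ends c ->
  (forall j, inr j \notin unzip2 c) -> r < size c.
Proof.
move=> gc cl; have := gc => /graph_cycle_walk[v [e [vj vL eL cE eS]]].
have ec t : e t \in unzip2 c by apply/cE; exists t.
have [x0 [b0 e0]] : exists x b, e 0 = inl (x, b).
  case e0: (e 0) (ec 0) => [[x b]|j]; first by exists x, b.
  by rewrite (negPf (cl j)).
have c1 : 1 < size c by apply: (@spoke_cycle_gt1 _ _ _ _ _ x0 b0 gc); rewrite -e0; exact: ec.
have [t0 [c0 vt0]] : exists t0 c0, v t0 = inl (inr c0).
  have := vj 0; rewrite e0 /joins /= => /orP[] /eqP[v0 v1].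
    by exists 1, (cayley_center x0 b0).
  by exists 0, (cayley_center x0 b0).
(* The default is never reached, because [c] has no extra edge. *)
pose pr (f : spoke (G * 'I_d)%type k) := if f is inl p then p else (x0, b0).
pose x s := (pr (e (t0 + s.*2))).1; pose b s := (pr (e (t0 + s.*2))).2.
have prE t : e t = inl (pr (e t)).
  by case E: (e t) (ec t) => [//|j]; rewrite (negPf (cl j)).
have step s c' : v (t0 + s.*2) = inl (inr c') ->
    [/\ c' = cayley_center (x s) (b s),
        e (t0 + s.*2).+1 = inl (x s, ~~ b s)
      & v (t0 + s.+1.*2) = inl (inr (cayley_center (x s) (~~ b s)))].
  move=> vc; have eE : e (t0 + s.*2) = inl (x s, b s).
    by rewrite prE /x /b; case: (pr _).
  have [cc vl] : c' = cayley_center (x s) (b s) /\ v (t0 + s.*2).+1 = inl (inl (x s)).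
    by have := vj (t0 + s.*2); rewrite eE vc /joins => /orP[] /eqP[] // <- ->.
  have [b' eb] : exists b', e (t0 + s.*2).+1 = inl (x s, b').
    apply: (@incident_leaf _ _ _ cayley_center); rewrite -vl.
    by case/joins_incident/andP: (vj (t0 + s.*2).+1).
  have bb : b' = ~~ b s.
    by have := eS c1 (t0 + s.*2); rewrite eE eb; case: (b') (b s) => [] [] //; rewrite eqxx.
  rewrite -bb; split => //.
  have := vj (t0 + s.*2).+1; rewrite eb vl doubleS !addnS /joins.
  by case/orP => /eqP[] // ->.
have vE s : v (t0 + s.*2) = inl (inr (cayley_center (x s) (b s))).
  elim: s => [|s IH]; first by rewrite addn0 vt0; case: (step 0 c0 _) => [|<-]; rewrite ?addn0.
  have [_ _ h] := step s _ IH.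
  by case: (step s.+1 _ h) => <-.
have bS s : b s.+1 = ~~ b s.
  by have [_ _ h] := step s _ (vE s); move: h; rewrite vE => -[].
have cS s : cayley_center (x s.+1) (b s.+1) = cayley_center (x s) (~~ b s).
  have [_ _ h] := step s _ (vE s); move: h; rewrite vE.
  by move/(congr1 (fun u => if u is inl (inr c') then c' else c0)).
have xS s : (x s.+1).2 != (x s).2.
  apply/eqP => xx; have := cS s; rewrite bS => /cayley_center_inj /(_ xx) xE.
  have [_ h _] := step s _ (vE s); have := eS c1 (t0 + s.*2).+1.
  by rewrite h -!addnS -doubleS prE -/(pr _) -xE -bS /x /b; case: (pr _) => ? ? /=; rewrite eqxx.
rewrite ltnNge; apply/negP => cr.
(* Indices count double steps, so [size c] of them go around the cycle twice; this avoids proving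
   that its length is even. *)
suff : (cayley_center (x (size c)) (b (size c))).1 != (cayley_center (x 0) (b 0)).1.
  by rewrite /x /b -addnn addnA !eL addn0 eqxx.
apply: (@toggle_walk_aperiodic d r (fun s => (cayley_center (x s) (b s)).1)
  (fun s => (x s).2)).
- by move=> s; rewrite cS cayley_center_flip.
- exact: xS.
- by rewrite cr andbT; lia.
Qed.

Lemma cayley_cycle_size c : graph_cycle ends c -> k <= r.+1 -> k <= size c.
Proof.
move=> gc kr; have [[j jc]|cl] := pselect (exists j, inr j \in unzip2 c).
  exact: extra_cycle_full gc jc.
apply: leq_trans kr (cayley_cycle_long gc _) => j.
by apply/negP => jc; apply: cl; exists j.
Qed.

End CayleyCenters.

Local Open Scope classical_set_scope.
Local Open Scope ring_scope.

(** * Integration against the law of the values *)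

Lemma integral_probability_cst (R : realType) d (T : measurableType d) (P : probability T R)
  (K : R) : (\int[P]_x K%:E = K%:E)%E.
Proof.
rewrite integral_cst // [X in (_ * X)%E](_ : _ = 1%E) ?mule1 //.
exact: probability_setT.
Qed.

Section ValuesLaw.
Context {R : realType} (I : prophet_instance R).
Local Notation E := (ground I).

Lemma measurable_value (e : E) : measurable_fun [set: values I] (fun v => value v e).
Proof. exact: measurable_tnth. Qed.

Lemma measurable_box (B : E -> set R) : (forall e, measurable (B e)) ->
  measurable [set v : values I | forall e, B e (value v e)].
Proof.
move=> mB.
have -> : [set v : values I | forall e, B e (value v e)] =
    \big[setI/setT]_(e : E) ((fun v => value v e) @^-1` B e).
  apply/seteqP; split => v /=; rewrite -bigcap_seq /=.
    by move=> h e _; exact: h.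
  by move=> h e; apply: h; rewrite /= mem_index_enum.
apply: bigsetI_measurable => e _; rewrite -[X in measurable X]setTI.
by apply: measurable_value => //; exact: mB.
Qed.

Lemma values_law_box (B : E -> set R) : (forall e, measurable (B e)) ->
  values_law I [set v | forall e, B e (value v e)]
  = (\prod_(i < #|E|) law (enum_val i) (B (enum_val i)))%E.
Proof.
move=> mB; rewrite -tuple_probabilityE; last by move=> i; exact: mB.
congr (values_law I _); apply/seteqP; split => v /= h.
  by move=> i; have := h (enum_val i); rewrite /value enum_valK.
by move=> e; have := h (enum_rank e); rewrite enum_rankK.
Qed.

Lemma values_law_ae (B : E -> set R) : (forall e, measurable (B e)) ->
  (forall e, law e (B e) = 1%E) ->
  {ae values_law I, forall v, forall e, B e (value v e)}.
Proof.
move=> mB B1; exists (~` [set v | forall e, B e (value v e)]).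
have mG := measurable_box mB; split; [exact: measurableC| |by []].
rewrite probability_setC // values_law_box // big1 ?subee // => i _; exact: B1.
Qed.

Lemma values_law_marginal (e : E) (A : set R) : measurable A ->
  values_law I [set v | A (value v e)] = law e A.
Proof.
move=> mA; pose B f := if f == e then A else setT.
have mB f : measurable (B f) by rewrite /B; case: ifP.
have -> : [set v : values I | A (value v e)] = [set v | forall f, B f (value v f)].
  apply/seteqP; split => v /= h; last by have := h e; rewrite /B eqxx.
  by move=> f; rewrite /B; case: eqP => [->|].
rewrite values_law_box // (bigD1 (enum_rank e)) //= big1 ?mule1; last first.
  move=> i ie; rewrite /B ifF ?probability_setT //.
  by apply: contraNF ie => /eqP <-; rewrite enum_valK.
by rewrite enum_rankK /B eqxx.
Qed.

(** Both the lower bound on the prophet and the upper bound on the algorithm have this shape; by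
    linearity only the probabilities of the single events enter. *)
Lemma integral_affine_indic (X : finType) (H : X -> set (values I)) (p K : R) (a b : X -> R) :
  (forall x, measurable (H x)) -> (forall x, values_law I (H x) = p%:E) ->
  (forall x, 0 <= a x) -> (forall x, 0 <= b x) -> 0 <= K ->
  (\int[values_law I]_v (\sum_x (a x + b x * \1_(H x) v) + K)%:E =
   (\sum_x (a x + b x * p) + K)%:E)%E.
Proof.
move=> mH Hp a0 b0 K0.
have t0 x v : (0 <= (a x + b x * \1_(H x) v)%:E)%E.
  by rewrite lee_fin addr_ge0 ?mulr_ge0.
have mi x : measurable_fun [set: values I] (fun v => (b x * \1_(H x) v)%:E : \bar R).
  by apply/measurable_EFinP; apply: measurable_funM => //; exact: measurable_indic.
have mt x : measurable_fun [set: values I] (fun v => (a x + b x * \1_(H x) v)%:E : \bar R).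
  apply/measurable_EFinP; apply: measurable_funD => //.
  by apply: measurable_funM => //; exact: measurable_indic.
under eq_integral do rewrite EFinD -sumEFin.
rewrite ge0_integralD //; last 2 first.
- by move=> v _; apply: sume_ge0.
- exact: emeasurable_sum.
rewrite ge0_integral_sum // integral_probability_cst EFinD -sumEFin.
congr (_ + _)%E; apply: eq_bigr => x _.
under eq_integral do rewrite EFinD.
rewrite ge0_integralD //; last 2 first.
- by move=> v _; rewrite lee_fin.
- by move=> v _; rewrite lee_fin mulr_ge0.
rewrite integral_probability_cst EFinD; congr (_ + _)%E.
under eq_integral do rewrite EFinM.
rewrite ge0_integralZl //; last 2 first.
- by apply/measurable_EFinP; exact: measurable_indic.
- by rewrite lee_fin.
by rewrite integral_indic // setIT EFinM; congr (_ * _)%E; exact: Hp.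
Qed.

Lemma measurable_total_value (S : {set E}) :
  measurable_fun [set: values I] (fun v => total_value v S).
Proof.
have -> : (fun v : values I => total_value v S) = 
    (fun v => \sum_(e <- enum S) value v e).
  by apply/funext => v; rewrite /total_value big_enum.
by apply: measurable_sum => e; exact: measurable_value.
Qed.

Lemma measurable_prophet_value : measurable_fun [set: values I] (@prophet_value R I).
Proof.
suff H (s : seq {set E}) : measurable_fun [set: values I]
    (fun v => \big[Order.max/0]_(S <- s | S \in feasible I) total_value v S) by exact: H.
elim: s => [|S s IH].
  rewrite (_ : (fun v => _) = cst 0); first exact: measurable_cst.
  by apply/funext => v; rewrite big_nil.
case: (boolP (S \in feasible I)) => SF; last first.
  rewrite (_ : (fun v => _) =
    (fun v => \big[Order.max/0]_(S <- s | S \in feasible I) total_value v S)) //.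
  by apply/funext => v; rewrite big_cons (negPf SF).
rewrite (_ : (fun v => _) = (fun v => Order.max (total_value v S)
    (\big[Order.max/0]_(S <- s | S \in feasible I) total_value v S))).
  by apply: measurable_maxr => //; exact: measurable_total_value.
by apply/funext => v; rewrite big_cons SF.
Qed.

Lemma prophet_value_ge0 (v : values I) : 0 <= prophet_value v.
Proof. exact: bigmax_ge_id. Qed.

Lemma le_prophet_value (v : values I) (S : {set E}) :
  S \in feasible I -> total_value v S <= prophet_value v.
Proof. by move=> SF; exact: (le_bigmax_cond _ (total_value v)). Qed.

Section Algorithm.
Context (s : seq E) d (W : measurableType d) (A : online_algorithm s W).

Lemma measurable_reward : measurable_fun [set: W * values I]
  (fun x => total_value x.2 (accepted A x.1 x.2)).
Proof.
have -> : (fun x : W * values I => total_value x.2 (accepted A x.1 x.2)) = 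
    (fun x => \sum_e (value x.2 e * \1_[set y : W * values I | e \in accepted A y.1 y.2] x)).
  apply/funext => x; rewrite /total_value big_mkcond; apply: eq_bigr => e _.
  rewrite indicE; case: ifPn => eA; first by rewrite mem_set ?mulr1.
  by rewrite memNset ?mulr0 //; exact/negP.
apply: measurable_sum => e; apply: measurable_funM.
  exact: (measurableT_comp (measurable_value e) measurable_snd).
by apply: measurable_indic; exact: accepted_measurable.
Qed.

Lemma accepted_all_feasible w v : arrival_order s -> accepted A w v \in feasible I.
Proof.
move=> sE; have := accepted_feasible A w v (size s); rewrite take_size.
suff -> : [set e in accepted A w v | e \in s]%SET = accepted A w v by [].
by apply/setP => e; rewrite inE (perm_mem sE) mem_enum andbT.
Qed.

(** Randomization cannot beat the best seed. Absolute values make Tonelli applicable, since the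
    values are nonnegative only almost surely. *)
Lemma expected_reward_le (Q : probability W R) (K : R) : 0 <= K ->
  (forall w, \int[values_law I]_v `|total_value v (accepted A w v)|%:E <= K%:E)%E ->
  ('E_(Q \x values_law I)[fun x => total_value x.2 (accepted A x.1 x.2)] <= K%:E)%E.
Proof.
move=> K0 hK; rewrite expectation.unlock.
have mf := measurable_reward.
have mfE : measurable_fun [set: W * values I]
    (fun x => `|total_value x.2 (accepted A x.1 x.2)|%:E : \bar R).
  by apply/measurable_EFinP; apply: measurableT_comp mf.
apply: le_trans (lee_abs _) _.
apply: le_trans (le_abse_integral _ _ _) _ => //; first exact/measurable_EFinP.
have -> : (fun x : W * values I => `|(total_value x.2 (accepted A x.1 x.2))%:E|%E) =
  (fun x => `|total_value x.2 (accepted A x.1 x.2)|%:E) by [].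
rewrite fubini_tonelli1 //.
have -> : K%:E = (\int[Q]_w K%:E)%E by rewrite integral_probability_cst.
apply: ge0_le_integral => //.
- by move=> w _; apply: integral_ge0 => v _; rewrite lee_fin.
- by apply: measurable_fun_fubini_tonelli_F => // x; rewrite lee_fin.
- by move=> w _; exact: hK.
Qed.

End Algorithm.
End ValuesLaw.

(** * The prophet and the online algorithm on the hard instance *)

Section HardInstance.
Context {R : realType} (X C : finType) (k : nat) (center : X -> bool -> C) (p : R).
Hypotheses (p0 : 0 < p) (p1 : p <= 1).
Local Notation E := (spoke X k).
Local Notation ends := (@spoke_ends X C k center).

(* The value of [e] as a function of a coin that shows [true] with probability [p]. *)
Definition coin_value (e : E) (coin : bool) : R :=
  match e with
  | inl (_, true) => if coin then p^-1 else 0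
  | inl (_, false) => 1
  | inr _ => 0
  end.

Lemma measurable_coin_value e : measurable_fun [set: bool] (coin_value e).
Proof. by []. Qed.

HB.instance Definition _ e :=
  isMeasurableFun.Build _ _ _ _ (coin_value e) (measurable_coin_value e).

Definition coin_law (e : E) : probability R R :=
  distribution (bernoulli_prob p) (coin_value e).

Lemma coin_lawE e (A : set R) :
  (coin_law e A = p%:E * \d_(coin_value e true) A + (1 - p)%:E * \d_(coin_value e false) A)%E.
Proof.
have p01 : 0 <= p <= 1 by rewrite ltW.
exact: (bernoulli_probE p01 (coin_value e @^-1` A)).
Qed.

Lemma coin_law1 e (A : set R) :
  A (coin_value e true) -> A (coin_value e false) -> coin_law e A = 1%E.
Proof.
move=> At Af; rewrite coin_lawE !diracE !mem_set // !mule1 -EFinD.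
by congr (_%:E); rewrite /=; ring.
Qed.

Definition forests : {set {set E}} := [set S | `[< forest ends S >]]%SET.

Lemma forestsP S : reflect (forest ends S) (S \in forests).
Proof. by rewrite inE; exact: asboolP. Qed.

Lemma forests0 : finset.set0 \in forests.
Proof.
apply/forestsP => -[|[x e] c] //= _ /(_ e).
by rewrite !inE eqxx => /(_ isT).
Qed.

Lemma forests_down (S T : {set E}) : S \subset T -> T \in forests -> S \in forests.
Proof. by move=> ST /forestsP fT; apply/forestsP; exact: forest_sub ST fT. Qed.

Lemma coin_law_ge0 e : coin_law e [set x : R | 0 <= x] = 1%E.
Proof.
by apply: coin_law1 => /=; case: e => [[x []]|j] //=; rewrite invr_ge0 ltW.
Qed.

Definition hard_instance : prophet_instance R :=
  ProphetInstance forests0 forests_down coin_law_ge0.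
Local Notation I := hard_instance.

Definition high (x : X) : set (values I) :=
  [set v | value (v : values I) (inl (x, true)) = p^-1].

Lemma measurable_high x : measurable (high x).
Proof.
rewrite -[X in measurable X]setTI.
by apply: (@measurable_value _ I (inl (x, true)) _ [set p^-1]).
Qed.

Lemma high_prob x : values_law I (high x) = p%:E.
Proof.
apply: etrans (@values_law_marginal _ I (inl (x, true)) [set p^-1] _) _ => //.
apply: etrans (coin_lawE _ _) _; rewrite !diracE /=.
rewrite mem_set // memNset ?mule0 ?adde0 ?mule1 //=.
by move=> h; have := invr_gt0 p; rewrite -h ltxx p0.
Qed.

Definition typical (v : values I) : Prop :=
  forall e : ground I, value v e = coin_value e true \/ value v e = coin_value e false.

Lemma typical_ae : {ae values_law I, forall v, typical v}.
Proof.
apply: (@values_law_ae _ I (fun e => [set coin_value e true; coin_value e false])) => e.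
  by apply: measurableU.
by apply: coin_law1; [left|right].
Qed.

Lemma typical_value v : typical v ->
  [/\ forall x, value v (inl (x, false) : ground I) = 1,
      forall j, value v (inr j : ground I) = 0
    & forall x, value v (inl (x, true) : ground I) = p^-1 * \1_(high x) v].
Proof.
move=> tv; split => [x|j|x]; [by case: (tv (inl (x, false)))|by case: (tv (inr j))|].
rewrite indicE; case: (tv (inl (x, true))) => /= h.
  by rewrite mem_set ?mulr1.
rewrite memNset ?mulr0 // => h2; move: h; rewrite h2 => h.
by have := invr_gt0 p; rewrite h ltxx p0.
Qed.

Lemma typical_total v (S : {set E}) : typical v ->
  total_value v (S : {set ground I}) =
  \sum_x ((inl (x, false) \in S)%:R + (inl (x, true) \in S)%:R * (p^-1 * \1_(high x) v)).
Proof.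
move=> /typical_value[v1 v0 vp]; rewrite /total_value big_mkcond big_sumType /=.
rewrite [X in _ + X]big1 ?addr0; last by move=> j _; rewrite v0 if_same.
transitivity (\sum_x \sum_b
    if inl (x, b) \in S then value v (inl (x, b) : ground I) else 0).
  by rewrite pair_bigA; apply: eq_bigr => -[].
apply: eq_bigr => x _; rewrite big_bool /= v1 vp addrC.
by do 2 case: (_ \in S); rewrite ?mul1r ?mul0r.
Qed.

(** The witness takes, at each leaf, the high half if it is worth [p^-1] and the low half otherwise;
    this is a star forest. *)
Lemma le_prophet v : typical v ->
  \sum_x (1 + (p^-1 - 1) * \1_(high x) v) <= prophet_value v.
Proof.
move=> tv; pose S : {set E} :=
  [set e : E | if e is inl (x, b) then b == (v \in high x) else false]%SET.
have SF : S \in forests.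
  apply/forestsP/forest_star => [j|x b]; rewrite !inE // => /eqP ->.
  by case: (v \in high x).
apply: le_trans (@le_prophet_value _ I v S SF).
rewrite (typical_total S tv); apply: ler_sum => x _; rewrite !inE indicE.
by case: (v \in high x) => /=; rewrite ?(mulr1, mulr0, mul1r, mul0r); lra.
Qed.

(** Each leaf is charged its low half if chosen, and otherwise its high half. Only leaves with both
    halves chosen exceed this charge, each by at most [p^-1], and [forest_both] bounds their
    number. *)
Lemma forest_total_le v (S : {set E}) : typical v -> S \in forests ->
  total_value v (S : {set ground I}) <=
  \sum_x ((inl (x, false) \in S)%:R + ((inl (x, false) \notin S)%:R / p) * \1_(high x) v)
   + #|C|%:R / p.
Proof.
move=> tv /forestsP/forest_both; rewrite (typical_total S tv).
set B := [set x | _]%SET => hB.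
have pV : 0 < p^-1 by rewrite invr_gt0.
apply: (@le_trans _ _ (\sum_x ((inl (x, false) \in S)%:R
   + ((inl (x, false) \notin S)%:R / p) * \1_(high x) v + (x \in B)%:R / p))).
  apply: ler_sum => x _; rewrite inE.
  do 2 case: (_ \in S); rewrite indicE; case: (v \in high x) => /=; nra.
rewrite big_split /= lerD2l -mulr_suml ler_pM2r //.
by rewrite -natr_sum ler_nat -big_mkcond sum1_card.
Qed.

Lemma expected_prophet_ge :
  ((#|X|%:R * (2 - p))%:E <= 'E_(values_law I)[@prophet_value R I])%E.
Proof.
rewrite expectation.unlock; have b0 : 0 <= p^-1 - 1 by rewrite subr_ge0 invf_ge1.
(* Each leaf contributes [1 + (p^-1 - 1) * p = 2 - p]; the summand 0 fits the form of
   [integral_affine_indic]. *)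
have -> : (#|X|%:R * (2 - p))%:E = (\int[values_law I]_v
    (\sum_x (1 + (p^-1 - 1) * \1_(high x) v) + 0)%:E)%E.
  rewrite (@integral_affine_indic _ I _ high p 0 (fun=> 1) (fun=> p^-1 - 1)) //.
  - congr (_%:E); rewrite sumr_const addr0 -[RHS]mulr_natl; congr (_ * _).
    by field; rewrite gt_eqF.
  - exact: measurable_high.
  - exact: high_prob.
have mh x : measurable_fun [set: values I] (fun v => 1 + (p^-1 - 1) * \1_(high x) v : R).
  apply: measurable_funD => //; apply: measurable_funM => //.
  by apply: measurable_indic; exact: measurable_high.
apply: ae_ge0_le_integral => //.
- move=> v _; rewrite lee_fin addr0; apply: sumr_ge0 => x _.
  by rewrite addr_ge0 ?mulr_ge0.
- apply/measurable_EFinP; apply: measurable_funD => //; exact: measurable_sum.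
- by move=> v _; rewrite lee_fin prophet_value_ge0.
- by apply/measurable_EFinP; exact: measurable_prophet_value.
- apply: filterS typical_ae => v tv _; rewrite lee_fin addr0; exact: le_prophet.
Qed.

Definition is_high_edge (e : E) : bool := if e is inl (_, b) then b else false.

Definition low_first : seq (ground I) :=
  [seq e <- enum (ground I) | ~~ is_high_edge e]
  ++ [seq e <- enum (ground I) | is_high_edge e].

Lemma low_first_order : arrival_order low_first.
Proof. by rewrite /arrival_order /low_first perm_catC perm_filterC. Qed.

Lemma low_first_index e e' : ~~ is_high_edge e ->
  (index e' low_first <= index e low_first)%N -> ~~ is_high_edge e'.
Proof.
move=> eh; have inL f :
    (f \in [seq e <- enum (ground I) | ~~ is_high_edge e]) = ~~ is_high_edge f.
  by rewrite mem_filter mem_enum andbT.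
rewrite /low_first !index_cat !inL eh.
case: ifP => // _; rewrite leqNgt => /negP[].
by apply: leq_trans (leq_addr _ _); rewrite index_mem inL.
Qed.

Section Algorithm.
Context d (W : measurableType d) (Q : probability W R)
  (A : online_algorithm low_first W).

(* Low edges have constant values, so the decisions on them depend on the seed alone. *)
Lemma low_decision w x : exists c : bool, forall v, typical v ->
  (inl (x, false) \in accepted A w v) = c.
Proof.
(* A reference realization: it agrees with every typical one on all edges that arrive no later than
   a low edge. *)
pose u : values I := [tuple coin_value (enum_val i) false | i < #|ground I|].
exists (inl (x, false) \in accepted A w u) => v tv.
apply: accepted_online => e /low_first_index; move=> /(_ isT).
rewrite [RHS]/value tnth_mktuple enum_rankK.
by case: (tv e) => ->; case: e => [[y []]|j].
Qed.

(** For a fixed seed the choice [c x] between the two halves is deterministic, and either choice has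
    mean 1, as [p^-1 * p = 1]. The remaining term pays for leaves with both halves. *)
Lemma expected_reward_bound :
  ('E_(Q \x values_law I)[fun x => total_value x.2 (accepted A x.1 x.2)]
   <= (#|X|%:R + #|C|%:R / p)%:E)%E.
Proof.
have K0 : 0 <= #|C|%:R / p by rewrite divr_ge0 // ltW.
apply: expected_reward_le; first by rewrite addr_ge0.
move=> w; have [c cE] := choice (low_decision w).
have n0 x : 0 <= (~~ c x)%:R / p by rewrite divr_ge0 // ltW.
have -> : (#|X|%:R + #|C|%:R / p)%:E = (\int[values_law I]_v
   (\sum_x ((c x)%:R + (~~ c x)%:R / p * \1_(high x) v) + #|C|%:R / p)%:E)%E.
  rewrite (@integral_affine_indic _ I _ high p) //.
  - congr ((_ + _)%:E); rewrite -sumr_const; apply: eq_bigr => x _.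
    by rewrite divfK ?gt_eqF //; case: (c x); rewrite /= ?addr0 ?add0r.
  - exact: measurable_high.
  - exact: high_prob.
have mh x : measurable_fun [set: values I]
    (fun v => (c x)%:R + (~~ c x)%:R / p * \1_(high x) v : R).
  apply: measurable_funD => //; apply: measurable_funM => //.
  by apply: measurable_indic; exact: measurable_high.
apply: ae_ge0_le_integral => //.
- apply/measurable_EFinP; apply: measurableT_comp => //.
  exact: (measurable_fun_pair2 w (measurable_reward A)).
- move=> v _; rewrite lee_fin addr_ge0 // sumr_ge0 // => x _.
  by rewrite addr_ge0 // mulr_ge0.
- apply/measurable_EFinP; apply: measurable_funD => //; exact: measurable_sum.
- apply: filterS typical_ae => v tv _; rewrite lee_fin ger0_norm; last first.
    rewrite (typical_total _ tv); apply: sumr_ge0 => x _.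
    by rewrite addr_ge0 ?mulr_ge0 // invr_ge0 ltW.
  apply: le_trans (forest_total_le tv (accepted_all_feasible A w v low_first_order)) _.
  by rewrite lerD2r; apply: ler_sum => x _; rewrite (cE x v tv).
Qed.

End Algorithm.

Lemma hard_instance_bound (a : R) : 0 <= a -> admits_prophet_inequality I a ->
  a * (#|X|%:R * (2 - p)) <= #|X|%:R + #|C|%:R / p.
Proof.
move=> a0 /(_ _ low_first_order)[d [W [Q [A h]]]].
rewrite -lee_fin EFinM; apply: le_trans (expected_reward_bound Q A).
by apply: le_trans h; apply: lee_wpmul2l expected_prophet_ge; rewrite lee_fin.
Qed.

End HardInstance.

(** * Girth and choice of the parameters *)

Lemma has_girth_cayley (d k : nat) : (0 < k)%N ->
  has_girth (forests k (@cayley_center d k)) k.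
Proof.
move=> k0; split.
  exists [set inr j | j : 'I_k]%SET.
    by apply/negP => /forestsP; exact: extra_cycle_dependent.
  by rewrite card_imset ?card_ord // => ? ? [].
move=> S; rewrite inE => /asboolP/forestPn[c gc cS].
apply: leq_trans (cayley_cycle_size gc (leqnSn k)) _.
rewrite -(size_map snd c) cardE; apply: uniq_leq_size.
  by case/and4P: gc.
by move=> e /cS; rewrite mem_enum.
Qed.

(** Here [n] counts the leaves and [2 * m] the centers. The right side exceeds [n] by
    [n * (2 * eps - eps * p - p / 2)], which is at least [n * eps / 2] because [p] is at most 1 and
    [eps]; the lower bound on [n] makes [2 * m / p] smaller than that. *)
Lemma competitive_gap (R : realType) (eps p n m : R) : 0 < eps -> 0 < p -> p <= 1 ->
  p <= eps -> 0 < m -> 4 / (eps * p) * m < n ->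
  n + 2 * m / p < (2^-1 + eps) * (n * (2 - p)).
Proof.
move=> e0 p0 p1 pe m0 hn.
have ep : 0 < eps * p by rewrite mulr_gt0.
have h : 4 * m < n * (eps * p).
  by rewrite -ltr_pdivrMr // mulrAC.
have n0 : 0 < n by apply: le_lt_trans hn; rewrite mulr_ge0 ?divr_ge0 // ltW.
have h2 : 2 * m / p < n * eps / 2.
  by rewrite ltr_pdivrMr //; lra.
have h3 : 0 <= n * (eps * (1 - p)).
  by do 2?[apply: mulr_ge0; first exact: ltW]; rewrite subr_ge0.
have h4 : 0 <= n * (eps - p) by apply: mulr_ge0; [exact: ltW | rewrite subr_ge0].
nra.
Qed.

Theorem theorem1p1 (R : realType) (k : nat) (eps : R)
    (hk : (1 <= k)%N) (heps : 0 < eps) :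
  exists I : prophet_instance R,
    [/\ graphic_matroid (feasible I),
        has_girth (feasible I) k
      & ~ admits_prophet_inequality I (2^-1 + eps)].
Proof.
pose p := Order.min 1 eps.
have p0 : 0 < p by rewrite lt_min ltr01.
have p1 : p <= 1 by rewrite ge_min lexx.
have pe : p <= eps by rewrite ge_min lexx orbT.
(* With [m] the order of the permutation group there are [d * m] leaves, so [d] must exceed
   [4 / (eps * p)]. *)
pose d := (Num.truncn (4 / (eps * p))).+1.
exists (hard_instance k (@cayley_center d k) p0 p1); split.
- exists (node ({perm k.-bseq 'I_d} * 'I_d)%type ({perm k.-bseq 'I_d} * bool)%type k).
  exists (@spoke_ends _ _ k (@cayley_center d k)) => S.
  by split => [/forestsP|h] //; apply/forestsP.
- exact: has_girth_cayley.
have a0 : 0 <= 2^-1 + eps by rewrite addr_ge0 ?invr_ge0 ?ltW.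
move=> /(hard_instance_bound a0).
apply/negP; rewrite -ltNge !card_prod card_ord card_bool natrM natrM [_ * 2]mulrC.
have m0 : 0 < #|{perm k.-bseq 'I_d}|%:R :> R.
  by rewrite ltr0n; apply/card_gt0P; exists 1%g.
apply: competitive_gap => //; rewrite [ltRHS]mulrC ltr_pM2r //.
exact: truncnS_gt.
Qed.
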